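(* Let $H$ be a Hilbert $C^*$-module and $Q\in\mathcal{L}(H)$ an idempotent. Let $C=\big(I-m(Q)-s(Q)\big)^2$. Then $C$ is invertible and $$Q=\tfrac12C^{-1}\Big[\big(C^{1/2}+s(Q)\big)\big(2m(Q)-I\big)+I-m(Q)\Big].$$
   Context: $H$ is a Hilbert module over a $C^*$-algebra, $\mathcal{L}(H)$ the adjointable operators. For $T$, $|T|=(T^*T)^{1/2}$ and $T^\dagger$ is the Moore–Penrose inverse. For an idempotent $Q$, the matched projection is $m(Q)=\tfrac12(|Q^*|+Q^* )|Q^*|^\dagger(|Q^*|+I)^{-1}(|Q^*|+Q)$, and the supplementary projection is $s(Q)=m(2P_{\mathcal{R}(Q)}-Q)$, where $P_{\mathcal{R}(Q)}$ is the projection onto $\mathcal{R}(Q)$. *)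

(* Defs.v *)
From Stdlib Require Import ClassicalEpsilon.
From mathcomp Require Import all_boot all_order all_algebra.
From mathcomp Require Import reals complex.

Set Implicit Arguments.
Unset Strict Implicit.
Unset Printing Implicit Defensive.

Import Order.TTheory GRing.Theory Num.Theory.
Local Open Scope ring_scope.

(* The C*-algebra L(H) of adjointable operators on a Hilbert C*-module H is  *)
(* the instance of interest; conversely every unital C*-algebra A is L(A_A). *)
(* An algebra A is a unitAlgType over R[i]: its unit predicate is exactly    *)
(* two-sided invertibility and x^-1 is the two-sided inverse of a unit.      *)

Section CStar.
Variable R : realType.
Local Notation C := R[i].
Variable A : unitAlgType C.

Record is_cstar_algebra (star : A -> A) (nrm : A -> R) : Prop := {
  starD : forall x y, star (x + y) = star x + star y;
  starZ : forall (a : C) x, star (a *: x) = conjc a *: star x;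
  starM : forall x y, star (x * y) = star y * star x;
  starK : forall x, star (star x) = x;
  nrm_ge0 : forall x, 0 <= nrm x;
  nrm_eq0 : forall x, nrm x = 0 -> x = 0;
  nrm_triangle : forall x y, nrm (x + y) <= nrm x + nrm y;
  nrmZ : forall (a : C) x, nrm (a *: x) = ComplexField.Normc.normc a * nrm x;
  nrm_submul : forall x y, nrm (x * y) <= nrm x * nrm y;
  nrm_cstar : forall x, nrm (star x * x) = nrm x ^+ 2;
  nrm_complete : forall u : nat -> A,
    (forall e : R, 0 < e -> exists N : nat, forall m n : nat,
        (N <= m)%N -> (N <= n)%N -> nrm (u m - u n) < e) ->
    exists l : A, forall e : R, 0 < e -> exists N : nat, forall n : nat,
        (N <= n)%N -> nrm (u n - l) < e
}.

Variable star : A -> A.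

Definition cpositive (a : A) : Prop := exists x : A, a = star x * x.

Definition csqrt (a : A) : A :=
  epsilon (inhabits 0) (fun b => cpositive b /\ b * b = a).

Definition cabs (T : A) : A := csqrt (star T * T).

Definition mpinv (T : A) : A :=
  epsilon (inhabits 0) (fun X =>
    [/\ T * X * T = T, X * T * X = X,
        star (T * X) = T * X & star (X * T) = X * T]).

(* P_{R(Q)}: the orthogonal projection (P = P^2 = P^* ) with the same range as
   the idempotent Q; R(Q) <= R(P) iff P Q = Q, and R(P) <= R(Q) iff Q P = P. *)
Definition range_proj (Q : A) : A :=
  epsilon (inhabits 0) (fun P =>
    [/\ P * P = P, star P = P, P * Q = Q & Q * P = P]).

Definition matched_proj (Q : A) : A :=
  let aQ := cabs (star Q) in
  (2^-1 : C) *: ((aQ + star Q) * mpinv aQ * (aQ + 1)^-1 * (aQ + Q)).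

Definition supp_proj (Q : A) : A :=
  matched_proj (2%:R * range_proj Q - Q).

End CStar.

(* Main.v *)
(* Put K = 1 - (Q - Q')^2 with Q' = star Q. It commutes with Q and Q', is at least 1,
   and equals (Q + Q' - 1)^2. With S = K^(1/2) and P = Q Q' K^-1 the range projection,
   one gets |Q'| = S P and 2 m(Q) - 1 = S^-1 (Q + Q' - 1). The idempotent 2 P - Q has
   the same K and P, so 1 - m - s = S^-1 (1 - 2 P) and C = S^-2; the formula then
   reduces to P (Q + Q' - 1) = Q. No functional calculus is used: square roots near 1
   come from a contraction, and the uniqueness of the positive roots is reduced to
   the fact that h = (star y) y with h^3 = h is idempotent. *)
Require Import Defs.
From Stdlib Require Ncring Ncring_tac.
From mathcomp Require Import all_boot all_order all_algebra.
From mathcomp Require Import reals complex ring lra.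

Set Implicit Arguments.
Unset Strict Implicit.
Unset Printing Implicit Defensive.

Import Order.TTheory GRing.Theory Num.Theory.
Local Open Scope ring_scope.

(** * Normalization of identities in noncommutative rings *)

#[local] Instance nc_ring_ops (A : pzRingType) :
  @Ncring.Ring_ops A 0 1 +%R *%R (fun x y => x - y) -%R eq := {}.

#[local] Instance nc_ring (A : pzRingType) : Ncring.Ring (Ro := nc_ring_ops A).
Proof.
split; first exact: RelationClasses.eq_equivalence.
all: try by move=> ? ? -> ? ? ->.
- by move=> ? ? ->.
- exact: add0r.
- exact: (@addrC A).
- exact: (@addrA A).
- exact: mul1r.
- exact: mulr1.
- exact: mulrA.
- exact: (@mulrDl A).
- by move=> x y z; exact: (@mulrDr A).
- by [].
- exact: (@subrr A).
Qed.

Ltac nc_ring := Ncring_tac.non_commutative_ring.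

Section CStarTheory.
Variables (R : realType) (A : unitAlgType R[i]) (star : A -> A) (nrm : A -> R).
Hypothesis hA : is_cstar_algebra star nrm.

Let starD := starD hA.
Let starM := starM hA.
Let starK := starK hA.
Let nrm_ge0 := nrm_ge0 hA.
Let nrm_triangle := nrm_triangle hA.
Let nrm_submul := nrm_submul hA.

Local Notation "r *c x" := (r%:C%C *: x) (at level 40).

(** * Elementary norm estimates *)

Lemma normc_real (r : R) : ComplexField.Normc.normc r%:C%C = `|r|.
Proof. by rewrite /ComplexField.Normc.normc /= expr0n addr0 sqrtr_sqr. Qed.

Lemma nrm_scale (r : R) (x : A) : nrm (r *c x) = `|r| * nrm x.
Proof. by rewrite (nrmZ hA) normc_real. Qed.

Lemma nrm0 : nrm 0 = 0.
Proof. by rewrite -(scale0r (0 : A)) (nrmZ hA) ComplexField.Normc.normc0 mul0r. Qed.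

Lemma nrmN (x : A) : nrm (- x) = nrm x.
Proof.
have -> : - x = (-1) *c x by rewrite rmorphN1 scaleN1r.
by rewrite nrm_scale normrN1 mul1r.
Qed.

Lemma nrmB (x y : A) : nrm (x - y) <= nrm x + nrm y.
Proof. by rewrite -(nrmN y). Qed.

Lemma nrm_distC (x y : A) : nrm (x - y) = nrm (y - x).
Proof. by rewrite -opprB nrmN. Qed.

Lemma nrm_double (x : A) : nrm (x + x) = 2 * nrm x.
Proof.
have -> : x + x = 2 *c x by rewrite rmorph_nat scaler_nat mulr2n.
by rewrite nrm_scale ger0_norm.
Qed.

Lemma nrm_eq0_le (x : A) : nrm x <= 0 -> x = 0.
Proof. by move=> h; apply: (nrm_eq0 hA); apply/eqP; rewrite eq_le h nrm_ge0. Qed.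

Lemma nrm_le_mul (x y : A) (a b : R) : nrm x <= a -> nrm y <= b -> nrm (x * y) <= a * b.
Proof. by move=> ha hb; apply: le_trans (nrm_submul x y) _; apply: ler_pM. Qed.

(** * Geometric decay and fixed points of contractions *)

(** 1 - q^n is (1 - q) times a sum of n powers of q, each at least q^n. This bounds q^n by a
    multiple of 1/n, enough for convergence to 0. *)
Lemma geometric_bound (q : R) (n : nat) : 0 <= q -> q <= 1 ->
  n%:R * (1 - q) * q ^+ n <= 1 - q ^+ n.
Proof.
move=> q0 q1; elim: n => [|n IH]; first by rewrite !mul0r subrr.
have := exprn_ge0 n q0; have := exprn_ile1 n.+1 q0 q1.
rewrite -natr1 exprS => h1 h0.
have h2 := ler_wpM2l q0 IH.
have : 0 <= (1 - q) * (1 - q * q ^+ n) by apply: mulr_ge0; rewrite subr_ge0.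
by nra.
Qed.

Lemma geometric_small (q c e : R) : 0 <= q -> q < 1 -> 0 <= c -> 0 < e ->
  exists N : nat, forall n, (N <= n)%N -> q ^+ n * c < e.
Proof.
move=> q0 q1 c0 e0.
have q10 : 0 < 1 - q by rewrite subr_gt0.
have [N hN] : exists N : nat, c / ((1 - q) * e) < N%:R.
  exists (Num.bound (c / ((1 - q) * e))); apply: archi_boundP.
  by apply: divr_ge0 => //; apply: ltW; apply: mulr_gt0.
exists N => n Nn.
have {}hN : c < n%:R * ((1 - q) * e).
  rewrite -ltr_pdivrMr ?mulr_gt0 //; apply: lt_le_trans hN _.
  by rewrite ler_nat.
have hb := geometric_bound n q0 (ltW q1).
have p0 := exprn_ge0 n q0.
(* Multiplying the strict inequality by [q ^+ n] requires it to be nonzero. *)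
case: (eqVneq (q ^+ n) 0) => [->|pn0]; first by rewrite mul0r.
have pp : 0 < q ^+ n by rewrite lt_def pn0.
have h1 : q ^+ n * c < q ^+ n * (n%:R * ((1 - q) * e)) by rewrite ltr_pM2l.
apply: lt_le_trans h1 _.
have -> : q ^+ n * (n%:R * ((1 - q) * e)) = n%:R * (1 - q) * q ^+ n * e by ring.
rewrite -[leRHS]mul1r ler_wpM2r ?(ltW e0) //.
by apply: le_trans hb _; rewrite gerBl.
Qed.

(** Banach iteration started at 0. Working in a ball admits the quadratic map of [sqrt_near1], which
    contracts only near 0. *)
Lemma contraction_fixpoint (f : A -> A) (q r : R) :
  0 <= q -> q < 1 -> 0 <= r ->
  (forall x, nrm x <= r -> nrm (f x) <= r) ->
  (forall x y, nrm x <= r -> nrm y <= r -> nrm (f x - f y) <= q * nrm (x - y)) ->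
  exists2 x, nrm x <= r & f x = x.
Proof.
move=> q0 q1 r0 fr fq.
pose u n := iter n f 0.
have ur n : nrm (u n) <= r.
  by elim: n => [|n IH]; [rewrite nrm0 | exact: fr].
have us n : nrm (u n.+1 - u n) <= q ^+ n * r.
  elim: n => [|n IH]; first by rewrite subr0 mul1r; exact: ur.
  rewrite exprS -mulrA; apply: le_trans (ler_wpM2l q0 IH).
  exact: fq (u n.+1) (u n) (ur _) (ur _).
have q10 : 0 < 1 - q by rewrite subr_gt0.
(* The telescoped geometric sum, multiplied through by 1 - q to avoid division. *)
have um n k : (1 - q) * nrm (u (n + k)%N - u n) <= q ^+ n * r * (1 - q ^+ k).
  elim: k => [|k IH]; first by rewrite addn0 subrr nrm0 subrr !mulr0.
  have h1 := us (n + k)%N.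
  have h2 := nrm_triangle (u (n + k).+1 - u (n + k)%N) (u (n + k)%N - u n).
  rewrite addrA subrK in h2.
  rewrite addnS exprS; rewrite exprD in h1.
  have h3 : (1 - q) * nrm (u (n + k).+1 - u n) <=
    (1 - q) * (q ^+ n * q ^+ k * r + nrm (u (n + k)%N - u n)).
    by rewrite ler_wpM2l ?(ltW q10) //; lra.
  by nra.
have [l hl] : exists l : A, forall e : R, 0 < e -> exists N : nat,
    forall n : nat, (N <= n)%N -> nrm (u n - l) < e.
  apply: (nrm_complete hA) => e e0.
  have [N hN] := geometric_small q0 q1 r0 (mulr_gt0 q10 (divr_gt0 e0 (ltr0Sn R 1))).
  have hu n : (N <= n)%N -> nrm (u n - u N) < e / 2.
    move=> Nn; rewrite -(ltr_pM2l q10).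
    rewrite -(subnKC Nn); apply: le_lt_trans (um _ _) _.
    apply: le_lt_trans (hN N (leqnn N)).
    rewrite ler_piMr ?mulr_ge0 ?exprn_ge0 //.
    by rewrite gerBl exprn_ge0.
  exists N => m n Nm Nn.
  have := nrm_triangle (u m - u N) (u N - u n).
  rewrite addrA subrK (nrm_distC (u N)).
  by have := hu _ Nm; have := hu _ Nn; lra.
have lr : nrm l <= r.
  apply/ler_addgt0Pr => e e0; have [N /(_ N (leqnn N)) hN] := hl e e0.
  have := nrm_triangle (u N) (l - u N); rewrite addrC subrK (nrm_distC l).
  by have := ur N; lra.
exists l => //; apply/eqP; rewrite -subr_eq0; apply/eqP; apply: nrm_eq0_le.
apply/ler_addgt0Pr => e e0; have [N hN] := hl _ (divr_gt0 e0 (ltr0Sn R 1)).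
have h1 := hN N (leqnn N); have h2 := hN N.+1 (leqnSn N).
have := nrm_triangle (f l - f (u N)) (f (u N) - l); rewrite addrA subrK.
have := fq _ _ lr (ur N); rewrite (nrm_distC l).
have := nrm_ge0 (u N - l).
rewrite /= in h2; by nra.
Qed.


(** * The involution and the C*-identity *)

Lemma star0 : star 0 = 0.
Proof. by apply: (addrI (star 0)); rewrite -starD !addr0. Qed.

Lemma starN (x : A) : star (- x) = - star x.
Proof. by apply: (addrI (star x)); rewrite -starD !subrr star0. Qed.

Lemma starB (x y : A) : star (x - y) = star x - star y.
Proof. by rewrite starD starN. Qed.

Lemma star1 : star 1 = 1.
Proof. by rewrite -[LHS]mulr1 -{2}(starK 1) -starM mulr1 starK. Qed.

Lemma star_scale (r : R) (x : A) : star (r *c x) = r *c star x.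
Proof. by rewrite (starZ hA) /= oppr0. Qed.

Lemma star_i_sub_star (x : A) : star ('i%C *: (x - star x)) = 'i%C *: (x - star x).
Proof.
rewrite (starZ hA) starB starK -[LHS]opprK -scalerN opprB -scaleNr; congr (_ *: _).
by apply/eqP; rewrite eq_complex /= oppr0 opprK !eqxx.
Qed.

(** The C*-identity and submultiplicativity bound the square of [nrm y] by [nrm (star y) * nrm y];
    cancel, then exchange y and [star y]. *)
Lemma nrm_star (x : A) : nrm (star x) = nrm x.
Proof.
suff le y : nrm y <= nrm (star y).
  by apply: le_anti; rewrite le andbT; have := le (star x); rewrite starK.
have [->|n0] := eqVneq (nrm y) 0; first exact: nrm_ge0.
have yp : 0 < nrm y by rewrite lt_def n0 nrm_ge0.
by rewrite -(ler_pM2r yp) -expr2 -(nrm_cstar hA).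
Qed.

Lemma nrm_proj_le1 (p : A) : p * p = p -> star p = p -> nrm p <= 1.
Proof.
move=> pp sp; have := nrm_cstar hA p; rewrite sp pp => h.
have [->|n0] := eqVneq (nrm p) 0; first exact: ler01.
have yp : 0 < nrm p by rewrite lt_def n0 nrm_ge0.
by rewrite -(ler_pM2r yp) -expr2 mul1r -h.
Qed.

Lemma nrm1_le : nrm 1 <= 1.
Proof. by apply: nrm_proj_le1; rewrite ?mulr1 ?star1. Qed.

Lemma eq_small_mul (e a : A) : nrm a < 1 -> e = a * e -> e = 0.
Proof.
move=> a1 he; apply: nrm_eq0_le; have := nrm_submul a e; rewrite -he.
by have := nrm_ge0 e; nra.
Qed.

(** Taking norms gives 2|e| <= 2r|e|. With e = xy - yx or e = [star y] - y, commutation and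
    self-adjointness pass from k to its root y without following the iteration. *)
Lemma double_eq_small (e a b : A) (r : R) : r < 1 -> nrm a <= r -> nrm b <= r ->
  e + e = e * a + b * e -> e = 0.
Proof.
move=> r1 ha hb he; apply: nrm_eq0_le.
have h1 := nrm_triangle (e * a) (b * e); rewrite -he nrm_double in h1.
have h2 := nrm_le_mul (lexx (nrm e)) ha.
have h3 := nrm_le_mul hb (lexx (nrm e)).
by have := nrm_ge0 e; nra.
Qed.

(** * Inverses and roots obtained from contractions *)

Lemma neumann_unit (k : A) : nrm k < 1 -> 1 - k \is a GRing.unit.
Proof.
move=> k1; have k10 : 0 < 1 - nrm k by rewrite subr_gt0.
have k0 := nrm_ge0 k.
have [|x xr|x y _ _|x _ hx] := @contraction_fixpoint
    (fun x => k + k * x) (nrm k) (nrm k / (1 - nrm k)) k0 k1.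
- by rewrite divr_ge0 // ltW.
- apply: le_trans (nrm_triangle _ _) _.
  apply: (@le_trans _ _ (nrm k + nrm k * (nrm k / (1 - nrm k)))).
    by rewrite lerD2l; apply: nrm_le_mul.
  by rewrite le_eqVlt; apply/orP; left; apply/eqP; field; lra.
- have -> : k + k * x - (k + k * y) = k * (x - y) by nc_ring.
  exact: nrm_submul.
(* The equation x = k + k x makes 1 + x a right inverse only. The commutator e of k and x satisfies
   e = k e, so it vanishes and the inverse is two-sided. *)
have xk : k * x - x * k = 0.
  apply: (@eq_small_mul _ k k1).
  transitivity (k * (k + k * x) - (k + k * x) * k); first by rewrite !hx.
  by nc_ring.
have kx : k * x = x - k by rewrite -[in RHS]hx; nc_ring.
have {}xk : x * k = x - k by rewrite -kx; apply/esym/eqP; rewrite -subr_eq0 xk.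
apply/unitrP; exists (1 + x); split.
  have -> : (1 + x) * (1 - k) = 1 + x - k - x * k by nc_ring.
  by rewrite xk; nc_ring.
have -> : (1 - k) * (1 + x) = 1 + x - k - k * x by nc_ring.
by rewrite kx; nc_ring.
Qed.

(* (1 - y)^2 = 1 - k is the fixed point equation y = (k + y^2) / 2. *)
Lemma sqrt_near1 (k : A) (r : R) : r < 1 -> nrm k <= r ->
  exists y, [/\ nrm y <= r, (1 - y) * (1 - y) = 1 - k,
    forall x, x * k = k * x -> x * y = y * x & star k = k -> star y = y].
Proof.
move=> r1 kr; have r0 : 0 <= r := le_trans (nrm_ge0 k) kr.
pose f (y : A) := 2^-1 *c (k + y * y).
have half0 : `|2^-1 : R| = 2^-1 by rewrite ger0_norm // invr_ge0.
have [x xr|x y xr yr|y yr fy] := @contraction_fixpoint f r r r0 r1 r0.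
- rewrite /f nrm_scale half0.
  have := nrm_triangle k (x * x); have := nrm_le_mul xr xr.
  by nra.
- rewrite /f -scalerBr nrm_scale half0.
  have -> : k + x * x - (k + y * y) = x * (x - y) + (x - y) * y by nc_ring.
  have := nrm_triangle (x * (x - y)) ((x - y) * y).
  have := nrm_le_mul xr (lexx (nrm (x - y))).
  have := nrm_le_mul (lexx (nrm (x - y))) yr.
  by lra.
have yy : y + y = k + y * y.
  rewrite -[in LHS]fy /f -scalerDl -rmorphD /=.
  have -> : 2^-1 + 2^-1 = 1 :> R by lra.
  by rewrite rmorph1 scale1r.
have y2 : y * y = y + y - k by rewrite yy; nc_ring.
exists y; split => // [|x xk|sk].
- have -> : (1 - y) * (1 - y) = 1 - y - y + y * y by nc_ring.
  by rewrite y2; nc_ring.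
- apply/eqP; rewrite -subr_eq0; apply/eqP; apply: (double_eq_small r1 yr yr).
  have -> : x * y - y * x + (x * y - y * x) = x * (y + y) - (y + y) * x by nc_ring.
  by rewrite yy mulrDr mulrDl xk; nc_ring.
- apply/eqP; rewrite -subr_eq0; apply/eqP.
  have syr : nrm (star y) <= r by rewrite nrm_star.
  apply: (double_eq_small r1 yr syr).
  have -> : star y - y + (star y - y) = star (y + y) - (y + y) by rewrite starD; nc_ring.
  by rewrite yy starD starM sk; nc_ring.
Qed.

(* u = w + i sqrt(t - w^2) satisfies star u * u = t. *)
Lemma nrm_sub_sqr_le (w : A) (t : R) : star w = w -> nrm w ^+ 2 < t ->
  nrm (t *c 1 - w * w) <= t.
Proof.
move=> sw wt; have t0 : 0 < t := le_lt_trans (sqr_ge0 _) wt.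
pose k := t^-1 *c (w * w).
have k1 : nrm k < 1.
  rewrite nrm_scale ger0_norm ?invr_ge0 ?(ltW t0) // mulrC ltr_pdivrMr // mul1r.
  by apply: le_lt_trans wt; rewrite expr2.
have [y [_ yk yc ys]] := sqrt_near1 k1 (lexx _).
have sk : star k = k by rewrite star_scale starM sw.
have {}ys := ys sk.
have wk : w * k = k * w by rewrite /k -scalerAr -scalerAl mulrA.
have wy := yc w wk.
(* As 1 - y is a root of 1 - w^2/t, V plays the role of i sqrt(t - w^2): it is skew-adjoint and
   commutes with w. *)
pose si := Complex 0 (Num.sqrt t); pose V : A := si *: (1 - y).
have sV : star V = - V.
  rewrite (starZ hA) starB star1 ys -scaleNr; congr (_ *: _).
  by apply/eqP; rewrite eq_complex /= oppr0 !eqxx.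
have sisq : si * si = - t%:C%C.
  apply/eqP; rewrite eq_complex /= !(mulr0, mul0r, oppr0, addr0) sub0r -expr2.
  by rewrite sqr_sqrtr ?(ltW t0) // !eqxx.
have VV : V * V = w * w - t *c 1.
  rewrite -scalerAl -scalerAr scalerA yk sisq scaleNr scalerBr scalerA.
  by rewrite -rmorphM /= mulfV ?gt_eqF // scale1r opprB.
have wV : w * V = V * w by rewrite -scalerAr -scalerAl mulrBr mulrBl wy mulr1 mul1r.
have uu : nrm (w + V) ^+ 2 <= t.
  rewrite -(nrm_cstar hA) starD sw sV.
  have -> : (w - V) * (w + V) = w * w + w * V - V * w - V * V by nc_ring.
  rewrite wV VV; have -> : w * w + V * w - V * w - (w * w - t *c 1) = t *c 1 by nc_ring.
  by rewrite nrm_scale gtr0_norm // ler_piMr ?nrm1_le // ltW.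
(* V is half of u - [star u] for u = w + V, so its norm is at most that of u. *)
have Vu : nrm V <= nrm (w + V).
  have := nrmB (w + V) (star (w + V)); rewrite nrm_star.
  have -> : w + V - star (w + V) = V + V by rewrite starD sw sV; nc_ring.
  by rewrite nrm_double; lra.
rewrite nrm_distC -VV; apply: le_trans (nrm_le_mul Vu Vu) _.
by rewrite -expr2.
Qed.

(** Write 1 + w^2 = (1 + t)(1 - k) with k = (t - w^2)/(1 + t). By [nrm_sub_sqr_le], |k| <= t/(1 + t)
    < 1, so [sqrt_near1] applies twice. *)
Lemma fourth_root_1_add_sqr (w : A) : star w = w ->
  exists d, [/\ d \is a GRing.unit, star d = d, (d * d) * (d * d) = 1 + w * w &
    forall x, x * (w * w) = (w * w) * x -> x * d = d * x].
Proof.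
move=> sw; pose t := nrm w ^+ 2 + 1.
have t0 : 0 <= t by rewrite addr_ge0 ?sqr_ge0.
have wt : nrm w ^+ 2 < t by rewrite ltrDl.
have ht := nrm_sub_sqr_le sw wt.
have t10 : 0 < 1 + t by lra.
pose k := (1 + t)^-1 *c (t *c 1 - w * w); pose r := (1 + t)^-1 * t.
have kr : nrm k <= r.
  by rewrite nrm_scale ger0_norm ?invr_ge0 ?(ltW t10) // ler_wpM2l // invr_ge0 ltW.
have r1 : r < 1 by rewrite /r mulrC ltr_pdivrMr // mul1r; lra.
have [y [yr yk yc ys]] := sqrt_near1 r1 kr.
have [z [zr zy zc zs]] := sqrt_near1 r1 yr.
have sk : star k = k by rewrite star_scale starB star_scale starM sw star1.
pose c := Num.sqrt (Num.sqrt (1 + t)).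
have c0 : 0 < c by rewrite !sqrtr_gt0.
have c4 : c ^+ 4 = 1 + t.
  by rewrite (exprM c 2 2) /c !sqr_sqrtr // ?sqrtr_ge0 // ltW.
exists (c *c (1 - z)); split.
- rewrite scaler_unit ?unitfE ?fmorph_eq0 ?gt_eqF //.
  exact: neumann_unit (le_lt_trans zr r1).
- by rewrite star_scale starB star1 (zs (ys sk)).
- have -> : c *c (1 - z) * (c *c (1 - z)) = (c ^+ 2) *c (1 - y).
    by rewrite -scalerAl -scalerAr scalerA -rmorphM -expr2 zy.
  rewrite -scalerAl -scalerAr scalerA -rmorphM -exprD c4 yk scalerBr scalerA.
  rewrite -rmorphM /= mulfV ?gt_eqF // scale1r rmorphD /= scalerDl rmorph1 scale1r.
  by nc_ring.
- move=> x xw; have xk : x * k = k * x.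
    by rewrite -scalerAr -scalerAl mulrBr mulrBl xw -scalerAr -scalerAl mulr1 mul1r.
  by rewrite -scalerAr -scalerAl mulrBr mulrBl (zc _ (yc _ xk)) mulr1 mul1r.
Qed.


(** * Uniqueness of positive square roots *)

(* E = (h^2 - h) / 2 is the spectral projection of h at -1: for z = y E both
   E = - z^* z and F = - z z^* are projections, while - 2 (E + F) is a sum of two
   self-adjoint squares, so that |2 t + 2 E + 2 F| <= 2 t for large t. *)
Lemma cpositive_cube_idem (h : A) : cpositive star h -> h * h * h = h -> h * h = h.
Proof.
move=> [y hy] h3; have sh : star h = h by rewrite hy starM starK.
pose g := h * h - h; pose E : A := 2^-1 *c g.
have half2 : 2^-1 + 2^-1 = 1 :> R by lra.
have EE2 : E + E = g by rewrite -scalerDl -rmorphD /= half2 rmorph1 scale1r.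
have gg : g * g = g + g.
  have -> : g * g = h * h * h * h - h * h * h - h * h * h + h * h by rewrite /g; nc_ring.
  by rewrite h3 /g; nc_ring.
have EE : E * E = E.
  rewrite -scalerAl -scalerAr scalerA gg scalerDr -scalerDl -rmorphM -rmorphD /=.
  by congr (_%:C%C *: _); lra.
have sE : star E = E by rewrite star_scale starB starM sh.
have hE : h * E = - E.
  by rewrite -scalerAr /g mulrBr mulrA h3 -scalerN opprB.
pose z := y * E.
have zz : star z * z = - E by rewrite starM sE mulrA -(mulrA E) -hy -mulrA hE mulrN EE.
have zE : z * E = z by rewrite /z -mulrA EE.
pose F := - (z * star z).
have FF : F * F = F.
  have -> : F * F = z * (star z * z) * star z by rewrite /F; nc_ring.
  by rewrite zz mulrN zE mulNr.
have sF : star F = F by rewrite starN starM starK.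
(* Twice the real part of z and, up to sign, twice its imaginary part; the cross terms cancel in a^2
   + b^2. *)
pose a := z + star z; pose b : A := 'i%C *: (z - star z).
have sa : star a = a by rewrite starD starK addrC.
have sb : star b = b.
  exact: star_i_sub_star.
have aabb : a * a + b * b = - (E + E + F + F).
  rewrite -scalerAl -scalerAr scalerA -(expr2 'i%C) sqr_i scaleN1r.
  have -> : a * a - (z - star z) * (z - star z) =
    star z * z + star z * z + (z * star z + z * star z) by rewrite /a; nc_ring.
  by rewrite zz /F; nc_ring.
pose t := nrm a ^+ 2 + nrm b ^+ 2 + 1.
have a0 := sqr_ge0 (nrm a); have b0 := sqr_ge0 (nrm b).
have t0 : 0 <= t by rewrite /t; lra.
have hta : nrm (t *c 1 - a * a) <= t by apply: nrm_sub_sqr_le; rewrite // /t; lra.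
have htb : nrm (t *c 1 - b * b) <= t by apply: nrm_sub_sqr_le; rewrite // /t; lra.
have hF : nrm (1 - F) <= 1.
  apply: nrm_proj_le1; last by rewrite starB star1 sF.
  by have -> : (1 - F) * (1 - F) = 1 - F - F + F * F; [nc_ring | rewrite FF; nc_ring].
(* X is the sum of t - a^2, t - b^2 and 2(1 - F), so its norm is at most 2t + 2. But X E = (2t + 4)
   E, which forces E = 0. *)
pose X : A := (t + t + 2) *c 1 + E + E.
have hX : nrm X <= t + t + 2.
  have -> : X = (t *c 1 - a * a) + (t *c 1 - b * b) + ((1 - F) + (1 - F)).
    have -> : (t *c 1 - a * a) + (t *c 1 - b * b) + ((1 - F) + (1 - F)) =
      t *c 1 + t *c 1 + 1 + 1 - F - F - (a * a + b * b) by nc_ring.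
    by rewrite aabb /X !rmorphD /= !scalerDl rmorph1 scale1r; nc_ring.
  apply: le_trans (nrm_triangle _ _) _; rewrite nrm_double.
  by have := nrm_triangle (t *c 1 - a * a) (t *c 1 - b * b); lra.
have XE : X * E = (t + t + 4) *c E.
  rewrite !mulrDl EE -scalerAl mul1r (_ : t + t + 4 = t + t + 2 + 1 + 1); last lra.
  by rewrite !rmorphD /= !scalerDl rmorph1 !scale1r.
have E0 : E = 0.
  apply: nrm_eq0_le; have := nrm_le_mul hX (lexx (nrm E)).
  rewrite XE nrm_scale ger0_norm; last by lra.
  by have := nrm_ge0 E; nra.
by apply/eqP; rewrite -subr_eq0 -/g -EE2 E0 addr0.
Qed.

Lemma starV (d : A) : d \is a GRing.unit -> star d = d -> star d^-1 = d^-1.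
Proof. by move=> du sd; apply: (mulIr du); rewrite mulVr // -{2}sd -starM divrr // star1. Qed.

(** h = d^-1 c d^-1 is again of the form [star x * x], and h^2 = p, h p = h give h^3 = h. Thus h =
    h^2 = p. The cases used are p a range projection and p = 1. *)
Lemma cpositive_root_unique (c d p : A) : cpositive star c ->
  d \is a GRing.unit -> star d = d -> c * d = d * c -> p * p = p -> c * p = c ->
  c * c = d * d * (d * d) * p -> c = d * d * p.
Proof.
move=> [y cy] du sd cd pp cp cc.
have cV : c * d^-1 = d^-1 * c := commrV cd.
pose h := d^-1 * c * d^-1.
have hV : h = d^-1 * d^-1 * c by rewrite /h -mulrA cV mulrA.
have hh : h * h = p.
  have -> : h * h = d^-1 * d^-1 * (c * d^-1 * d^-1) * c by rewrite hV; nc_ring.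
  rewrite cV -(mulrA d^-1 c) cV.
  have -> : d^-1 * d^-1 * (d^-1 * (d^-1 * c)) * c =
    d^-1 * d^-1 * d^-1 * d^-1 * (c * c) by nc_ring.
  by rewrite cc !mulrA !(mulrVK du) mulVr // mul1r.
have hp : h * p = h by rewrite hV -mulrA cp.
have hE : h * h = h.
  apply: cpositive_cube_idem; last by rewrite -mulrA hh hp.
  by exists (y * d^-1); rewrite starM starV // /h cy !mulrA.
by rewrite -hh hE hV !mulrA (mulrK du) mulrV // mul1r.
Qed.

(** * Values of the operations defined by choice *)

(** Uniqueness is a hypothesis because it is established only for the particular elements whose root
    is taken. *)
Lemma csqrt_eq (a b : A) : cpositive star b -> b * b = a ->
  (forall c, cpositive star c -> c * c = a -> c = b) -> csqrt star a = b.
Proof.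
move=> pb bb uniq; have [pc cc] : cpositive star (csqrt star a) /\ csqrt star a * csqrt star a = a.
  exact: (ClassicalEpsilon.epsilon_spec (inhabits 0)
    (fun b => cpositive star b /\ b * b = a) (ex_intro _ b (conj pb bb))).
exact: uniq.
Qed.

(** Penrose's argument: az and ax are self-adjoint idempotents with the same range, hence equal;
    similarly za = xa. Then z = zaz = xax = x. *)
Lemma mpinv_eq (a x : A) : a * x * a = a -> x * a * x = x ->
  star (a * x) = a * x -> star (x * a) = x * a -> mpinv star a = x.
Proof.
move=> axa xax sax sxa; set P := fun X : A =>
  [/\ a * X * a = a, X * a * X = X, star (a * X) = a * X & star (X * a) = X * a].
have : P (mpinv star a).
  by apply: (ClassicalEpsilon.epsilon_spec (inhabits 0) P); exists x.
move: (mpinv star a) => z [aza zaz saz sza].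
have e1 : a * z = a * x.
  by rewrite -saz -{1}axa -(mulrA (a * x)) starM saz sax mulrA aza.
have e2 : z * a = x * a.
  by rewrite -sza -{1}axa mulrA mulrA -(mulrA (z * a)) starM sxa sza -mulrA (mulrA a z) aza.
by rewrite -zaz -mulrA e1 mulrA e2 xax.
Qed.

(** Two candidates X and P satisfy XP = P and PX = X; taking adjoints identifies them. *)
Lemma range_proj_eq (Q P : A) : P * P = P -> star P = P -> P * Q = Q -> Q * P = P ->
  range_proj star Q = P.
Proof.
move=> PP sP PQ QP; set S := fun P : A => [/\ P * P = P, star P = P, P * Q = Q & Q * P = P].
have : S (range_proj star Q).
  by apply: (ClassicalEpsilon.epsilon_spec (inhabits 0) S); exists P.
move: (range_proj star Q) => X [XX sX XQ QX].
have e : X * P = P by rewrite -QP mulrA XQ.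
have e' : P * X = X by rewrite -QX mulrA PQ.
by rewrite -e' -sP -sX -starM e.
Qed.

(** * Range projection, absolute value and matched projection of an idempotent *)

Section Idempotent.
(* d is the positive fourth root of K: conjugating by d^-1 instead of dividing by
   S = d^2 keeps elements of the form y^* y in that form. *)
Variables Q d : A.
Hypotheses (QQ : Q * Q = Q) (d_unit : d \is a GRing.unit) (sd : star d = d).
Let K := 1 - (Q - star Q) * (Q - star Q).
Hypothesis dK : d * d * (d * d) = K.
Hypothesis dC : forall x, x * K = K * x -> x * d = d * x.
Local Notation Q' := (star Q).
Let S := d * d.
Let P := Q * Q' * (S^-1 * S^-1).

Lemma star_idem : Q' * Q' = Q'.
Proof. by rewrite -starM QQ. Qed.
Let sQQ := star_idem.

Let KE : K = 1 - Q - Q' + Q * Q' + Q' * Q.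
Proof.
rewrite /K; have -> : 1 - (Q - Q') * (Q - Q') = 1 - Q * Q + Q * Q' + Q' * Q - Q' * Q' by nc_ring.
by rewrite QQ sQQ; nc_ring.
Qed.

(** These four products show that K commutes with Q and Q'; by [dC], so do d, S and S^-1. *)
Let QK : Q * K = Q * Q' * Q.
Proof. by rewrite KE !(mulrDr, mulrN) mulr1 !mulrA QQ; nc_ring. Qed.

Let KQ : K * Q = Q * Q' * Q.
Proof. by rewrite KE !(mulrDl, mulNr) mul1r -!mulrA QQ; nc_ring. Qed.

Let Q'K : Q' * K = Q' * Q * Q'.
Proof. by rewrite KE !(mulrDr, mulrN) mulr1 !mulrA sQQ; nc_ring. Qed.

Let KQ' : K * Q' = Q' * Q * Q'.
Proof. by rewrite KE !(mulrDl, mulNr) mul1r -!mulrA sQQ; nc_ring. Qed.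

Let dQ : Q * d = d * Q. Proof. by apply: dC; rewrite QK KQ. Qed.
Let dQ' : Q' * d = d * Q'. Proof. by apply: dC; rewrite Q'K KQ'. Qed.
Let Su : S \is a GRing.unit. Proof. by rewrite unitrMl. Qed.
Let SV : S * S^-1 = 1. Proof. exact: mulrV. Qed.
Let VS : S^-1 * S = 1. Proof. exact: mulVr. Qed.
Let dS (x : A) : x * d = d * x -> x * S = S * x.
Proof. by move=> h; rewrite /S mulrA h -mulrA h mulrA. Qed.
Let dV (x : A) : x * d = d * x -> x * S^-1 = S^-1 * x.
Proof. by move=> h; apply: commrV; exact: dS. Qed.
Let QV : Q * S^-1 = S^-1 * Q := dV dQ.
Let Q'V : Q' * S^-1 = S^-1 * Q' := dV dQ'.
Let sS : star S = S. Proof. by rewrite starM sd. Qed.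
Let sV : star S^-1 = S^-1 := starV Su sS.

Let PE : P = S^-1 * S^-1 * (Q * Q').
Proof. by rewrite /P -!mulrA (mulrA Q') Q'V -(mulrA _ Q') Q'V !mulrA QV -(mulrA _ Q) QV !mulrA. Qed.

Let SSV : S^-1 * S^-1 * K = 1.
Proof. by rewrite -dK -/S -mulrA (mulrA S^-1 S) VS mul1r VS. Qed.

(** P Q = K^-1 Q Q' Q = K^-1 K Q. *)
Let PQ : P * Q = Q.
Proof. by rewrite PE -(mulrA _ _ Q) -KQ mulrA SSV mul1r. Qed.

Let QP : Q * P = P.
Proof. by rewrite /P !mulrA QQ. Qed.

Let sP : star P = P.
Proof. by rewrite [in LHS]/P !starM sV starK PE. Qed.

Let PP : P * P = P.
Proof. by rewrite {2}/P !mulrA PQ -/P /P !mulrA. Qed.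

Let Q'P : Q' * P = Q'.
Proof. by rewrite -{1}sP -starM PQ. Qed.

Let PQ' : P * Q' = P.
Proof. by rewrite -{1}sP -starM QP sP. Qed.

Let dP : P * d = d * P.
Proof.
have dVd : GRing.comm d S^-1 by apply: dV.
by apply: commr_sym; apply: commrM; apply: commrM => //; apply: commr_sym.
Qed.
Let PS : P * S = S * P := dS dP.
Let PSP : P * S * P = S * P. Proof. by rewrite PS -(mulrA S) PP. Qed.
Let SPSP : S * P * (S * P) = S * S * P.
Proof. by rewrite -(mulrA S P) (mulrA P) PSP mulrA. Qed.
Let PSSP : P * (S * S * P) = S * S * P.
Proof. by rewrite -(mulrA S S) (mulrA P) PS -(mulrA S P) (mulrA P) PSP. Qed.
Let SSPP : S * S * P * P = S * S * P. Proof. by rewrite -(mulrA _ P) PP. Qed.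
Let PV : P * S^-1 = S^-1 * P := dV dP.

Let QQ' : Q * Q' = S * S * P.
Proof. by rewrite PE mulrA -(mulrA S) (mulrA S S^-1) SV mul1r SV mul1r. Qed.

Lemma range_proj_spec : let r := range_proj star Q in
  [/\ r * r = r, star r = r, r * Q = Q, Q * r = r & r * d = d * r].
Proof. by rewrite /= (@range_proj_eq Q P). Qed.

(** Both sides expand to K. Hence S^-1 (Q + Q' - 1) is a self-adjoint involution, as 2 m(Q) - 1
    should be. *)
Lemma sqr_sum_star_sub1 : (Q + Q' - 1) * (Q + Q' - 1) = S * S.
Proof.
have -> : (Q + Q' - 1) * (Q + Q' - 1) =
  Q * Q + Q' * Q' + Q * Q' + Q' * Q - Q - Q - Q' - Q' + 1 by nc_ring.
by rewrite QQ sQQ dK KE; nc_ring.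
Qed.

(** Q Q' = S^2 P is the square of S P, and S P is positive through y = d P. *)
Lemma cabs_star_idem : cabs star Q' = S * P.
Proof.
rewrite /cabs starK; apply: csqrt_eq.
- by exists (d * P); rewrite starM sd sP mulrA -(mulrA P d) PSP.
- by rewrite SPSP QQ'.
move=> c pc cc; have [y cy] := pc.
have sc : star c = c by rewrite cy starM starK.
(* For x = c - c P, [star x * x] is (1 - P) c^2 (1 - P), which vanishes because c^2 = S^2 P. *)
have Pc : P * c = c.
  pose x := c - c * P.
  have x0 : x = 0.
    apply: (nrm_eq0 hA); apply/eqP; rewrite -sqrf_eq0 -(nrm_cstar hA).
    rewrite /x starB starM sc sP.
    have -> : (c - P * c) * (c - c * P) =
      c * c - P * (c * c) - c * c * P + P * (c * c) * P by nc_ring.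
    by rewrite cc QQ' PSSP SSPP subrr sub0r addNr nrm0.
  have : star (c * P) = star c by rewrite -[c in RHS](subrK (c * P)) -/x x0 add0r.
  by rewrite starM sP sc.
have cP : c * P = c by rewrite -{1}sc -sP -starM Pc sc.
(* c K = c P K = c c^2 = c^2 c = K P c = K c. *)
have cK : c * K = K * c.
  have -> : c * K = c * (P * S * S) by rewrite -dK -/S -{1}cP; nc_ring.
  rewrite PS -(mulrA S) PS (mulrA S S) -QQ' -cc (mulrA c) cc QQ'.
  by rewrite -dK -/S -(mulrA _ P) Pc.
rewrite /S; apply: cpositive_root_unique => //; first exact: dC.
by rewrite cc QQ'.
Qed.

Lemma mpinv_cabs_star_idem : mpinv star (S * P) = S^-1 * P.
Proof.
have e1 : S * P * (S^-1 * P) = P.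
  by rewrite -(mulrA S P) (mulrA P) PV -(mulrA _ P) PP mulrA SV mul1r.
have e2 : S^-1 * P * (S * P) = P.
  by rewrite -(mulrA _ P) (mulrA P) PSP mulrA VS mul1r.
apply: mpinv_eq; rewrite ?e1 ?e2 ?sP //.
  by rewrite mulrA PS -(mulrA S) PP.
by rewrite mulrA PV -(mulrA _ P) PP.
Qed.

(** Doubling removes the scalar 1/2. The product collapses to U = (1 + S)^-1 times a sum that
    factors as (1 + S)(1 + S^-1 (Q + Q' - 1)). *)
Lemma matched_proj_idem :
  matched_proj star Q + matched_proj star Q = 1 + S^-1 * (Q + Q' - 1).
Proof.
have half2 : 2^-1 + 2^-1 = 1 :> R[i] by field.
rewrite /matched_proj cabs_star_idem mpinv_cabs_star_idem -scalerDl half2 scale1r.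
(* 1 + S = 1 + d^2 is the fourth power of a unit. *)
have [e [eu _ eS _]] := fourth_root_1_add_sqr sd.
have S1u : 1 + S \is a GRing.unit by rewrite -eS !unitrMl.
pose U := (1 + S)^-1.
have US : U * (1 + S) = 1 by rewrite mulVr.
have SU : (1 + S) * U = 1 by rewrite mulrV.
have Uc x : x * d = d * x -> x * U = U * x.
  by move=> h; apply: commrV; rewrite /GRing.comm mulrDr mulrDl mulr1 mul1r (dS h).
have PU := Uc _ dP; have Q'U := Uc _ dQ'.
have VU : S^-1 * U = U * S^-1.
  by apply: Uc; apply/esym; apply: dV.
(* S P + 1 is block diagonal: 1 + S on the range of P and 1 on its complement. *)
have inv : (S * P + 1)^-1 = P * U + 1 - P.
  have SP1u : (P * U + 1 - P) * (S * P + 1) = 1 /\ (S * P + 1) * (P * U + 1 - P) = 1.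
    split.
      have -> : (P * U + 1 - P) * (S * P + 1) =
        P * U * S * P + P * U + S * P + 1 - P * S * P - P by nc_ring.
      rewrite PU PSP -(mulrA U) -(mulrA U) PSP.
      have -> : U * (S * P) + U * P + S * P + 1 - S * P - P = U * (1 + S) * P + 1 - P by nc_ring.
      by rewrite US; nc_ring.
    have -> : (S * P + 1) * (P * U + 1 - P) =
      S * (P * P) * U + S * P + P * U + 1 - S * (P * P) - P by nc_ring.
    rewrite PP PU -(mulrA S) PU.
    have -> : S * (U * P) + S * P + U * P + 1 - S * P - P = (1 + S) * U * P + 1 - P by nc_ring.
    by rewrite SU; nc_ring.
  have u : S * P + 1 \is a GRing.unit by apply/unitrP; exists (P * U + 1 - P).
  by apply: (mulIr u); rewrite mulVr // SP1u.1.
rewrite inv.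
have -> : (S * P + Q') * (S^-1 * P) = P + S^-1 * Q'.
  have -> : (S * P + Q') * (S^-1 * P) = S * (P * S^-1) * P + Q' * S^-1 * P by nc_ring.
  by rewrite PV (mulrA S S^-1) SV mul1r PP Q'V -(mulrA _ Q') Q'P.
rewrite -mulrA.
(* P fixes S P + Q on the left, so only the block U survives. *)
have -> : (P * U + 1 - P) * (S * P + Q) = U * (S * P + Q).
  have -> : (P * U + 1 - P) * (S * P + Q) =
    P * U * S * P + P * U * Q + S * P + Q - P * S * P - P * Q by nc_ring.
  rewrite PU PSP PQ -(mulrA U) -(mulrA U) PSP -(mulrA U P) PQ.
  by nc_ring.
rewrite mulrA mulrDl PU -(mulrA S^-1) Q'U (mulrA S^-1) VU.
have -> : (U * P + U * S^-1 * Q') * (S * P + Q) =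
  U * (P * S * P + P * Q + S^-1 * (Q' * S) * P + S^-1 * (Q' * Q)) by nc_ring.
have -> : Q' * Q = S * S - 1 + Q + Q' - S * S * P by rewrite -QQ' dK KE; nc_ring.
rewrite PSP PQ (dS dQ') (mulrA S^-1) VS mul1r Q'P.
have -> : S^-1 * (S * S - 1 + Q + Q' - S * S * P) =
  S^-1 * S * S - S^-1 + S^-1 * Q + S^-1 * Q' - S^-1 * S * S * P by nc_ring.
rewrite VS mul1r; apply: (mulrI S1u); rewrite mulrA SU mul1r.
have -> : (1 + S) * (1 + S^-1 * (Q + Q' - 1)) =
  1 + S + S^-1 * (Q + Q' - 1) + S * S^-1 * (Q + Q' - 1) by nc_ring.
by rewrite SV; nc_ring.
Qed.

End Idempotent.

(** * The formula for Q *)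

Lemma double_inj (x y : A) : x + x = y + y -> x = y.
Proof.
have half2 (z : A) : 2^-1 *c (z + z) = z.
  rewrite scalerDr -scalerDl -rmorphD /=.
  by have -> : 2^-1 + 2^-1 = 1 :> R; [lra | rewrite rmorph1 scale1r].
by move=> h; rewrite -[x]half2 h half2.
Qed.

End CStarTheory.

Theorem theorem5p8 (R : realType) (A : unitAlgType R[i])
    (star : A -> A) (nrm : A -> R)
    (hA : is_cstar_algebra star nrm)
    (Q : A) (hQ : Q * Q = Q) :
  let m := matched_proj star Q in
  let s := supp_proj star Q in
  let Cm := (1 - m - s) ^+ 2 in
  Cm \is a GRing.unit /\
  Q = (2^-1 : R[i]) *:
        (Cm^-1 * ((csqrt star Cm + s) * (2%:R * m - 1) + 1 - m)).
Proof.
(* This w is self-adjoint and 1 + w^2 = K, so a fourth root d of K exists. *)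
move=> m s Cm; pose w : A := 'i%C *: (Q - star Q).
have sw : star w = w := star_i_sub_star hA Q.
have ww : 1 + w * w = 1 - (Q - star Q) * (Q - star Q).
  by rewrite -scalerAl -scalerAr scalerA -expr2 sqr_i scaleN1r.
have [d [du sd dK dC]] := fourth_root_1_add_sqr hA sw.
rewrite ww in dK.
have {}dC x : x * (1 - (Q - star Q) * (Q - star Q)) = (1 - (Q - star Q) * (Q - star Q)) * x ->
    x * d = d * x.
  by rewrite -ww mulrDr mulrDl mulr1 mul1r => /addrI; exact: dC.
have [] := range_proj_spec hA hQ du sd dK dC.
have m2 := matched_proj_idem hA hQ du sd dK dC.
have NN := sqr_sum_star_sub1 hA hQ dK.
rewrite /= -/m in m2 NN *.
set r := range_proj star Q => rr sr rQ Qr rd.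
pose Q2 := 2%:R * r - Q.
have Q2Q2 : Q2 * Q2 = Q2.
  rewrite /Q2; have -> : (2%:R * r - Q) * (2%:R * r - Q) =
    r * r + r * r + r * r + r * r - (r * Q + r * Q) - (Q * r + Q * r) + Q * Q.
    by rewrite !mulr2n; nc_ring.
  by rewrite rr rQ Qr hQ !mulr2n; nc_ring.
have sQ2 : star Q2 = 2%:R * r - star Q.
  by rewrite /Q2 (starB hA) !mulr2n !mulrDl !mul1r (starD hA) sr.
(* Q2 - [star Q2] = -(Q - [star Q]), so Q2 has the same K and the same d serves for s. *)
have K2 : (Q2 - star Q2) * (Q2 - star Q2) = (Q - star Q) * (Q - star Q).
  by rewrite sQ2 /Q2; nc_ring.
have s2 : s + s = 1 + (d * d)^-1 * (Q2 + star Q2 - 1).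
  by apply: (matched_proj_idem hA); rewrite ?K2.
rewrite sQ2 /Q2 in s2.
set S := d * d in m2 s2 NN.
have Su : S \is a GRing.unit by rewrite unitrMl.
set T := S^-1 in m2 s2.
have ST : S * T = 1 := mulrV Su.
have TS : T * S = 1 := mulVr Su.
have rT : r * T = T * r by apply: commrV; apply: commrM.
pose N := Q + star Q - 1.
have CE : Cm = T * T.
  (* The terms in Q and [star Q] cancel in 2m + 2s. The factor 1 - 2r is an involution commuting
     with T, so only T^2 survives squaring. *)
  have D : 1 - m - s = T * (1 - r - r).
    apply: double_inj; have -> : 1 - m - s + (1 - m - s) = 1 + 1 - (m + m) - (s + s) by nc_ring.
    by rewrite m2 s2 !mulr2n; nc_ring.
  rewrite /Cm D expr2.
  have -> : T * (1 - r - r) * (T * (1 - r - r)) = T * (T - r * T - r * T) * (1 - r - r) by nc_ring.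
  rewrite rT; have -> : T * (T - T * r - T * r) * (1 - r - r) =
    T * T + (T * T * (r * r) + T * T * (r * r) + T * T * (r * r) + T * T * (r * r)) -
    (T * T * r + T * T * r + T * T * r + T * T * r) by nc_ring.
  by rewrite rr addrK.
have Tu : T \is a GRing.unit by rewrite unitrV.
have Cu : Cm \is a GRing.unit by rewrite CE unitrMl.
have CV : Cm^-1 = S * S.
  apply: (mulIr Cu); rewrite mulVr // CE.
  by have -> : S * S * (T * T) = S * (S * T) * T; [nc_ring | rewrite ST mulr1 ST].
have dVu : d^-1 \is a GRing.unit by rewrite unitrV.
have TdV : T = d^-1 * d^-1.
  apply: (mulIr Su); rewrite TS /S.
  have -> : d^-1 * d^-1 * (d * d) = d^-1 * (d^-1 * d) * d by nc_ring.
  by rewrite mulVr // mulr1 mulVr.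
have sqrtC : csqrt star Cm = T.
  rewrite CE; apply: csqrt_eq => //; first by exists d^-1; rewrite (starV hA).
  move=> c pc cc.
  (* c commutes with its square [Cm], hence with the inverse S^2 = K, and by [dC] with d. *)
  have cS : c * (S * S) = S * S * c.
    apply: (mulrI Cu); apply: (mulIr Cu).
    have e : Cm * (S * S) = 1 by rewrite -CV mulrV.
    have e' : S * S * Cm = 1 by rewrite -CV mulVr.
    have -> : Cm * (c * (S * S)) * Cm = Cm * c * (S * S * Cm) by nc_ring.
    have -> : Cm * (S * S * c) * Cm = Cm * (S * S) * (c * Cm) by nc_ring.
    by rewrite e e' mulr1 mul1r CE -cc mulrA.
  rewrite TdV -[RHS]mulr1; apply: (cpositive_root_unique hA); rewrite ?mulr1 //.
  - exact: (starV hA).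
  - by apply: commrV; apply: dC; rewrite -dK.
  - by rewrite -TdV.
split=> //; rewrite sqrtC CV.
have rN : r * N = Q.
  have rQ' : r * star Q = r by rewrite -{1}sr -(starM hA) Qr sr.
  rewrite /N mulrBr mulrDr rQ mulr1 rQ'.
  by nc_ring.
(* The first doubling clears the scalar 1/2; the second makes m and s occur only as m + m and s +
   s. *)
apply: double_inj; rewrite -scalerDl.
have -> : 2^-1 + 2^-1 = 1 :> R[i] by field.
rewrite scale1r; apply: double_inj.
have -> : S * S * ((T + s) * (2%:R * m - 1) + 1 - m) + S * S * ((T + s) * (2%:R * m - 1) + 1 - m) =
  S * S * ((T + T + (s + s)) * ((m + m) - 1) + 1 + 1 - (m + m)) by rewrite !mulr2n; nc_ring.
rewrite m2 s2 -/N.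
have -> : 2%:R * r - Q + (2%:R * r - star Q) - 1 = r + r + r + r - 1 - 1 - N.
  by rewrite /N !mulr2n; nc_ring.
have TN : N * T = T * N.
  have e : N * (S * S) = S * S * N by rewrite -NN mulrA.
  by apply: commrV; apply: commrM; apply: dC; rewrite -dK.
(* The bracket becomes 4 T^2 r N - T^2 N^2 + 1. Since N^2 = S^2 the last two terms cancel, and r N =
   Q leaves 4Q. *)
have -> : S * S * ((T + T + (1 + T * (r + r + r + r - 1 - 1 - N))) *
    (1 + T * N - 1) + 1 + 1 - (1 + T * N)) =
  S * S * (T * (r * T * N + r * T * N + r * T * N + r * T * N - N * T * N) + 1) by nc_ring.
rewrite rT TN -(mulrA T N) -(mulrA T r) NN rN.
have -> : S * S * (T * (T * Q + T * Q + T * Q + T * Q - T * (S * S)) + 1) =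
  S * (S * T) * T * (Q + Q + Q + Q) - S * (S * T) * T * (S * S) + S * S by nc_ring.
by rewrite ST mulr1 ST; nc_ring.
Qed.
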